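(* Fix an integer base $b\ge 2$ and let $\mathcal{D}_b=\{0,1,\dots,b-1\}$. The constant \[ c_{\mathrm{dead}}(b):=\sum_{S\subseteq \mathcal{D}_b} (-1)^{|S|}\prod_{p\ \text{prime}}\left(1-\frac{\nu_{p,b}(S)}{p^2}\right) \] is well defined (each infinite product converges) and positive, and for every real $X\ge 3$, \[ D_b(X)=c_{\mathrm{dead}}(b)\,X+O_b\!\left(\frac{X}{\sqrt{\log X}}\right), \] where the implied constant depends only on $b$.
   Context: A positive integer is square-free if it is not divisible by any perfect square $>1$. A positive integer $N$ is a base-$b$ dead end if $N$ is square-free and for every digit $d\in\{0,1,\dots,b-1\}$ the integer $bN+d$ is not square-free. $D_b(X):=\#\{1\le N\le X: N\text{ is a base-}b\text{ dead end}\}$. For a prime $p$ and $S\subseteq\{0,\dots,b-1\}$, $\nu_{p,b}(S):=\#\{n\bmod p^2:\ p^2\mid n\text{ or } p^2\mid(bn+d)\text{ for some } d\in S\}$. *)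

(* Defs.v *)
From HB Require Import structures.
From mathcomp Require Import all_boot all_order all_algebra.
From mathcomp Require Import all_classical all_reals all_analysis.
Set Implicit Arguments. Unset Strict Implicit. Unset Printing Implicit Defensive.
Import Order.TTheory GRing.Theory Num.Theory numFieldNormedType.Exports.

(* n is square-free: n > 0 and no k > 1 has k^2 dividing n
   (only k <= n need be checked since n > 0). *)
Definition squarefree (n : nat) : bool :=
  (0 < n) && all (fun k => ~~ (k ^ 2 %| n)) (iota 2 n).

Definition dead_end (b N : nat) : bool :=
  squarefree N && all (fun d => ~~ squarefree (b * N + d)) (iota 0 b).

Definition Dcount (R : realType) (b : nat) (X : R) : nat :=
  count (dead_end b) (iota 1 (Num.truncn X)).

Definition nu (p b : nat) (S : {set 'I_b}) : nat :=
  count (fun n => (p ^ 2 %| n) || [exists d in S, p ^ 2 %| b * n + d])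
        (iota 0 (p ^ 2)).

Definition partial_prod (R : realType) (b : nat) (S : {set 'I_b}) (M : nat) : R :=
  (\prod_(0 <= p < M | prime p) (1 - (nu p S)%:R / (p ^ 2)%:R))%R.

Definition c_dead (R : realType) (b : nat) : R :=
  (\sum_(S : {set 'I_b}) (-1) ^+ #|S| * limn (partial_prod R S))%R.

(* Main.v *)
(* By inclusion-exclusion over the set S of digits d for which b N + d is
   required to be square-free, D_b(X) is a signed sum of the counts A_S(X) of
   N <= X such that N and all b N + d (d in S) are square-free.  Sieving A_S by
   the primes p <= M is a periodic condition whose density is the partial
   product, by the Chinese remainder theorem; the error is at most the period,
   the product of the p^2.  The primes p > M change the count by O(X / M), as
   do the remaining factors of the infinite product.  Taking
   M = floor (sqrt (ln X)) keeps the period below X / M.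

   For positivity, choose distinct large primes p_d with p_d^2 | b N + d for
   0 < d < b, and a prime p | b dividing N exactly once.  These conditions
   define a residue class modulo some Q in which every square-free N is a dead
   end, and since sum_{k >= 2} 1/k^2 <= 3/4 < 1, square-free numbers have
   positive lower density in that class. *)

Require Import Defs.
From HB Require Import structures.
From mathcomp Require Import all_boot all_order all_algebra.
From mathcomp Require Import all_classical all_reals all_analysis.
From mathcomp Require Import zify ring lra.
Import Order.TTheory GRing.Theory Num.Theory numFieldNormedType.Exports.
Set Implicit Arguments.
Unset Strict Implicit.
Unset Printing Implicit Defensive.
Local Open Scope nat_scope.

(** * Counting periodic predicates *)

Lemma count_has_le (T U : Type) (P : U -> pred T) (ks : seq U) (s : seq T) :
  count (fun x => has (P^~ x) ks) s <= \sum_(k <- ks) count (P k) s.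
Proof.
elim: ks => [|k ks IH]; first by rewrite big_nil /= count_pred0.
rewrite big_cons; apply: leq_trans (leq_add (leqnn _) IH).
rewrite -count_predUI; apply: leq_trans (leq_addr _ _).
exact: sub_count.
Qed.

Lemma count_predU_le (T : Type) (f g : pred T) (s : seq T) :
  count (predU f g) s <= count f s + count g s.
Proof. by rewrite -count_predUI leq_addr. Qed.

Lemma sub_in_count (T : eqType) (f g : pred T) (s : seq T) :
  {in s, forall x, f x -> g x} -> count f s <= count g s.
Proof.
move=> fg; rewrite (@eq_in_count _ f (predI f g)); last first.
  by move=> x /fg /=; case: (f x) => // ->.
by apply: sub_count => x /andP[].
Qed.

Lemma count_iota_mul_periodic (f : pred nat) (Q q : nat) :
  (forall n, f (n + Q) = f n) ->
  count f (iota 0 (q * Q)) = q * count f (iota 0 Q).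
Proof.
move=> fQ.
have fqQ k n : f (k * Q + n) = f n.
  by elim: k n => [|k IH] n //; rewrite mulSn -addnA addnC fQ IH.
elim: q => [|q IH]; first by [].
rewrite mulSnr iotaD count_cat IH add0n [RHS]mulSnr; congr (_ + _).
rewrite -{1}[q * Q]addn0 iotaDl count_map.
by apply: eq_count => n /=; rewrite fqQ.
Qed.

(** The count is monotone in the length, and [n] lies between two consecutive multiples of [Q]. *)
Lemma count_iota_periodic (f : pred nat) (Q n : nat) :
  0 < Q -> (forall m, f (m + Q) = f m) ->
  n %/ Q * count f (iota 0 Q) <= count f (iota 0 n)
    <= (n %/ Q).+1 * count f (iota 0 Q).
Proof.
move=> Q0 fQ; rewrite -!count_iota_mul_periodic //.
have mono m1 m2 : m1 <= m2 -> count f (iota 0 m1) <= count f (iota 0 m2).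
  by move=> le_m; rewrite -(subnKC le_m) iotaD count_cat leq_addr.
apply/andP; split; apply: mono; first exact: leq_divM.
by apply: ltnW; rewrite ltn_ceil.
Qed.

(** Chinese remainder theorem in counting form: reduction modulo [Q] and modulo [R] is injective on
    residues modulo [Q * R], hence bijective by cardinality. *)
Lemma count_iota_coprime (f g : pred nat) (Q R : nat) :
  0 < Q -> 0 < R -> coprime Q R ->
  (forall n, f (n + Q) = f n) -> (forall n, g (n + R) = g n) ->
  count (predI f g) (iota 0 (Q * R)) =
    count f (iota 0 Q) * count g (iota 0 R).
Proof.
move=> Q0 R0 cop fQ gR.
have permod (h : pred nat) P n : (forall m, h (m + P) = h m) -> h n = h (n %% P).
  move=> hP; rewrite {1}(divn_eq n P) addnC.
  by elim: (n %/ P) => [|k IH]; rewrite ?addn0 // mulSnr addnA hP.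
have sumE (h : pred nat) P : count h (iota 0 P) = \sum_(i < P) h i.
  rewrite -[P in LHS]subn0 -/(index_iota 0 P) -(big_mkord predT (fun i => h i : nat)).
  by rewrite -sumn_count sumnE big_map.
rewrite !sumE big_distrlr /= pair_big /=.
pose F (x : 'I_(Q * R)) : 'I_Q * 'I_R :=
  (Ordinal (ltn_pmod x Q0), Ordinal (ltn_pmod x R0)).
have Finj : injective F.
  move=> x y /= [/eqP exy /eqP exy']; apply/val_inj/eqP => /=.
  have : x == y %[mod Q * R] by rewrite chinese_remainder // exy exy'.
  by rewrite !modn_small.
rewrite (reindex F) /=; last first.
  apply: onW_bij; apply: inj_card_bij => //.
  by rewrite card_prod !card_ord.
by apply: eq_bigr => x _; rewrite -(permod f) // -(permod g) // mulnb.
Qed.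

(** By induction on [n]: a hit at the new [N] is a fresh multiple of [q], so it raises the quotient
    by at least one. *)
Lemma count_dvd_affine (q b d n : nat) : 0 < q -> 0 < b ->
  count (fun N => q %| b * N + d) (iota 1 n) <= (b * n + d) %/ q.
Proof.
move=> q0 b0; elim: n => [|n IH] //.
rewrite -[in iota 1 _](addn1 n) iotaD count_cat /= addn0 add1n.
case: (boolP (q %| _)) => [dv|_] /=.
  rewrite addn1 (leq_ltn_trans IH) // ltn_divLR // divnK //.
  by rewrite mulnS; lia.
by rewrite addn0 (leq_trans IH) // leq_div2r // leq_add2r leq_pmul2l // leq_addr.
Qed.

(** * Sieving by squares of primes *)

Lemma squarefreeP (n : nat) :
  reflect (0 < n /\ forall k, 1 < k -> ~~ (k ^ 2 %| n)) (squarefree n).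
Proof.
apply: (iffP andP) => -[n0 H]; split => //.
  move=> k k1; apply/negP => dv; have le := dvdn_leq n0 dv.
  have: k \in iota 2 n by rewrite mem_iota k1 /=; nia.
  by move/(allP H); rewrite dv.
by apply/allP => k; rewrite mem_iota => /andP[k2 _]; apply: H.
Qed.

Lemma not_squarefree_prime (n : nat) : 0 < n -> ~~ squarefree n ->
  exists2 p, prime p & p ^ 2 %| n.
Proof.
move=> n0; rewrite /squarefree n0 /= -has_predC => /hasP[k].
rewrite mem_iota => /andP[k2 _] /=; rewrite negbK => dv.
have [p pp pk] := pdivP k2.
by exists p => //; apply: dvdn_trans dv; rewrite dvdn_exp2r.
Qed.

Definition sqfree_on (b : nat) (S : {set 'I_b}) (N : nat) : bool :=
  squarefree N && [forall d in S, squarefree (b * N + d)].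

(** Its count over one period [p ^ 2] is [nu p S]. *)
Definition obstructs (b : nat) (S : {set 'I_b}) (p N : nat) : bool :=
  (p ^ 2 %| N) || [exists d in S, p ^ 2 %| b * N + d].

Definition sifted (b : nat) (S : {set 'I_b}) (M N : nat) : bool :=
  all (fun p => prime p ==> ~~ obstructs S p N) (iota 0 M).

Definition sq_primorial (M : nat) : nat := \prod_(0 <= p < M | prime p) p ^ 2.

Lemma obstructsD (b : nat) (S : {set 'I_b}) (p c N : nat) :
  obstructs S p (N + c * p ^ 2) = obstructs S p N.
Proof.
rewrite /obstructs; congr orb; first by rewrite dvdn_addl // dvdn_mull.
apply: eq_existsb_in => d _.
by rewrite mulnDr addnAC dvdn_addl // mulnA dvdn_mull.
Qed.

Lemma sq_primorial_gt0 (M : nat) : 0 < sq_primorial M.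
Proof. by rewrite prodn_cond_gt0 // => p /prime_gt0; rewrite expn_gt0 => ->. Qed.

Lemma sq_primorialS (M : nat) :
  sq_primorial M.+1 = sq_primorial M * (if prime M then M ^ 2 else 1).
Proof. by rewrite /sq_primorial big_mkcond big_nat_recr //= -big_mkcond. Qed.

Lemma siftedS (b : nat) (S : {set 'I_b}) (M N : nat) :
  sifted S M.+1 N = sifted S M N && (prime M ==> ~~ obstructs S M N).
Proof. by rewrite /sifted -[M.+1]addn1 iotaD all_cat /= andbT add0n. Qed.

Lemma sifted_periodic (b : nat) (S : {set 'I_b}) (M N : nat) :
  sifted S M (N + sq_primorial M) = sifted S M N.
Proof.
rewrite /sifted; apply: eq_in_all => p; rewrite mem_iota add0n => /andP[_ pM].
case: (boolP (prime p)) => // pp /=; congr (~~ _).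
suff /dvdnP[c ->] : p ^ 2 %| sq_primorial M by rewrite obstructsD.
rewrite /sq_primorial big_mkcond (bigD1_seq p) ?iota_uniq ?mem_index_iota //=.
by rewrite pp dvdn_mulr.
Qed.

Lemma coprime_sq_primorial (M p : nat) : prime p -> M <= p ->
  coprime (sq_primorial M) (p ^ 2).
Proof.
move=> pp; elim: M => [|M IH] le; first by rewrite /sq_primorial big_nil coprime1n.
rewrite sq_primorialS coprimeMl IH /=; last exact: ltnW.
case: ifP => pM; last by rewrite coprime1n.
rewrite coprimeXl // coprimeXr // prime_coprime //.
by rewrite dvdn_prime2 // neq_ltn le.
Qed.

(** For prime [M] the new condition has period [M ^ 2], coprime to the old period, so the numbers of
    surviving residues multiply. This is the source of the Euler factor. *)
Lemma count_siftedS (b : nat) (S : {set 'I_b}) (M : nat) :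
  count (sifted S M.+1) (iota 0 (sq_primorial M.+1)) =
  count (sifted S M) (iota 0 (sq_primorial M))
    * (if prime M then M ^ 2 - nu M S else 1).
Proof.
rewrite sq_primorialS; case: ifP => pM; last first.
  by rewrite !muln1; apply: eq_count => N; rewrite siftedS pM andbT.
rewrite (eq_count (a2 := predI (sifted S M) (predC (obstructs S M)))); last first.
  by move=> N; rewrite siftedS pM.
rewrite count_iota_coprime ?sq_primorial_gt0 ?expn_gt0 ?prime_gt0 //.
- congr (_ * _); rewrite -{2}(size_iota 0 (M ^ 2)) -(count_predC (obstructs S M)).
  by rewrite addKn.
- exact: coprime_sq_primorial.
- exact: sifted_periodic.
- by move=> N /=; rewrite -{1}[M ^ 2]mul1n obstructsD.
Qed.

Lemma nu_le_mod (b p : nat) (S : {set 'I_b}) : nu p S <= p ^ 2.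
Proof. by rewrite -[leqRHS](size_iota 0) count_size. Qed.

(* If [n < p^2] and [p^2 | b n + d] with [d < b], the quotient is below [b]. *)
Lemma nu_le (b p : nat) (S : {set 'I_b}) : 0 < p -> nu p S <= b * b + 1.
Proof.
move=> p0; have q0 : 0 < p ^ 2 by rewrite expn_gt0 p0.
rewrite /nu; case: (p ^ 2) q0 => // q q0.
rewrite -[iota 0 q.+1]/([:: 0] ++ iota 1 q) count_cat addnC.
apply: leq_add; last exact: count_size.
apply: (@leq_trans (count
  (fun n => has (fun d => q.+1 %| b * n + d) (iota 0 b)) (iota 1 q))).
  rewrite -!size_filter; apply: uniq_leq_size; first by rewrite filter_uniq ?iota_uniq.
  move=> n; rewrite !mem_filter mem_iota => /andP[H /andP[n1 nq]].
  rewrite n1 nq !andbT; case/orP: H => [dv|/existsP[d /andP[_ dv]]].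
    by have := dvdn_leq n1 dv; lia.
  by apply/hasP; exists (d : nat); first by rewrite mem_iota /=.
apply: leq_trans (count_has_le _ _ _) _.
have -> : b * b = \sum_(d <- iota 0 b) b.
  by rewrite big_const_seq count_predT size_iota iter_addn_0.
rewrite big_seq [leqRHS]big_seq; apply: leq_sum => d.
rewrite mem_iota /= add0n => db.
have b0 : 0 < b by exact: leq_ltn_trans db.
apply: leq_trans (count_dvd_affine _ _ q0 b0) _.
by rewrite -ltnS ltn_divLR //; nia.
Qed.

Lemma sqfree_on_sifted (b : nat) (S : {set 'I_b}) (M N : nat) :
  sqfree_on S N -> sifted S M N.
Proof.
case/andP => /squarefreeP[N0 sqN] /forall_inP sqS.
apply/allP => p _; apply/implyP => /prime_gt1 p1.
rewrite /obstructs negb_or sqN //=; apply/existsP => -[d /andP[dS dv]].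
by have /squarefreeP[_ /(_ p p1)] := sqS d dS; rewrite dv.
Qed.

(** The square of the offending prime divides a positive integer below [b * N.+1]; the resulting
    bound keeps the union over large primes finite. *)
Lemma sifted_not_sqfree_on (b : nat) (S : {set 'I_b}) (M N : nat) : 0 < b ->
  0 < N -> sifted S M N -> ~~ sqfree_on S N ->
  exists2 p, M <= p < b * N.+1 & obstructs S p N.
Proof.
move=> b0 N0 siftN nsq.
have [p pp obs] : exists2 p, prime p & obstructs S p N.
  move: nsq; rewrite /sqfree_on negb_and => /orP[nsq|].
    have [p pp dv] := not_squarefree_prime N0 nsq.
    by exists p => //; rewrite /obstructs dv.
  rewrite negb_forall => /existsP[d]; rewrite negb_imply => /andP[dS nsq].
  have bN0 : 0 < b * N + d by rewrite addn_gt0 muln_gt0 b0 N0.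
  have [p pp dv] := not_squarefree_prime bN0 nsq.
  exists p => //; apply/orP; right; apply/existsP; exists d.
  by rewrite dS.
exists p => //; apply/andP; split.
  rewrite leqNgt; apply/negP => pM.
  have /allP/(_ p) := siftN; rewrite mem_iota add0n pM pp obs /=.
  by move=> /(_ isT).
have p0 := prime_gt0 pp.
case/orP: obs => [dv|/existsP[d /andP[_ dv]]].
  by have := dvdn_leq N0 dv; nia.
have /dvdn_leq : 0 < b * N + d by rewrite addn_gt0 muln_gt0 b0 N0.
by move=> /(_ _ dv); have := ltn_ord d; nia.
Qed.

Lemma count_obstructs_le (b : nat) (S : {set 'I_b}) (k n : nat) : 0 < b -> 0 < k ->
  count (obstructs S k) (iota 1 n) <= b.+1 * (b * n.+1 %/ k ^ 2).
Proof.
move=> b0 k0; have q0 : 0 < k ^ 2 by rewrite expn_gt0 k0.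
pose big N := has (fun d => k ^ 2 %| b * N + d) (iota 0 b).
apply: (@leq_trans (count (predU (fun N => k ^ 2 %| N) big) (iota 1 n))).
  apply: sub_count => N /orP[dv|/existsP[d /andP[_ dv]]]; apply/orP; first by left.
  by right; apply/hasP; exists (d : nat); first by rewrite mem_iota /=.
apply: leq_trans (count_predU_le _ _ _) _; rewrite mulSn; apply: leq_add.
  rewrite (@eq_count _ _ (fun N => k ^ 2 %| 1 * N + 0)); last first.
    by move=> N; rewrite mul1n addn0.
  apply: leq_trans (count_dvd_affine _ _ q0 _) _ => //.
  by apply: leq_div2r; nia.
apply: leq_trans (count_has_le _ _ _) _.
have -> : b * (b * n.+1 %/ k ^ 2) = \sum_(d <- iota 0 b) (b * n.+1 %/ k ^ 2).
  by rewrite big_const_seq count_predT size_iota iter_addn_0 mulnC.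
rewrite big_seq [leqRHS]big_seq; apply: leq_sum => d.
rewrite mem_iota /= add0n => db.
apply: leq_trans (count_dvd_affine _ _ q0 b0) _.
by apply: leq_div2r; nia.
Qed.

(** Union bound over the possible obstructions. The sum runs over all integers [k], prime or not,
    which is affordable because $\sum 1/k^2$ converges. *)
Lemma count_sifted_le (b : nat) (S : {set 'I_b}) (M n : nat) : 0 < b -> 0 < M ->
  count (sifted S M) (iota 1 n) <= count (sqfree_on S) (iota 1 n)
    + \sum_(M <= k < b * n.+1) b.+1 * (b * n.+1 %/ k ^ 2).
Proof.
move=> b0 M0.
pose big N := has (fun k => obstructs S k N) (index_iota M (b * n.+1)).
apply: (@leq_trans (count (predU (sqfree_on S) big) (iota 1 n))).
  apply: sub_in_count => N; rewrite mem_iota add1n ltnS => /andP[N1 Nn] siftN /=.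
  case: (boolP (sqfree_on S N)) => //= nsq.
  have [p /andP[Mp pb] obs] := sifted_not_sqfree_on b0 N1 siftN nsq.
  apply/hasP; exists p => //; rewrite mem_index_iota Mp (leq_trans pb) //.
  by rewrite leq_pmul2l.
apply: leq_trans (count_predU_le _ _ _) _; rewrite leq_add2l.
apply: leq_trans (count_has_le _ _ _) _.
rewrite big_seq [leqRHS]big_seq; apply: leq_sum => k.
rewrite mem_index_iota => /andP[Mk _]; apply: count_obstructs_le => //.
exact: leq_trans Mk.
Qed.

(** * A residue class of dead ends *)

(* Large auxiliary primes make [b N + d] non-square-free for every [0 < d < b]
   along a residue class; the digit [0] is handled by a prime factor [p] of
   [b] with [N = p] mod [p^2]. *)
Lemma dead_end_class (b : nat) : 1 < b ->
  exists Q a, [/\ 0 < Q, a < Q & forall N, N %% Q = a ->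
    (forall d, d < b -> ~~ squarefree (b * N + d)) /\
    (forall p, prime p -> p %| Q -> ~~ (p ^ 2 %| N))].
Proof.
move=> b1.
(* Induction on the number [m] of digits already handled. The second clause ensures that only primes
   not dividing [Q] have to be sieved out of the class later. *)
suff H m : 0 < m <= b ->
  exists Q a, 0 < Q /\ forall N, N = a %[mod Q] ->
    (forall d, d < m -> ~~ squarefree (b * N + d)) /\
    (forall p, prime p -> p %| Q -> ~~ (p ^ 2 %| N)).
  have [|Q [a [Q0 HQ]]] := H b; first by rewrite leqnn ltnW.
  exists Q, (a %% Q); split=> //; first by rewrite ltn_mod.
elim: m => // -[_ _|m IH /andP[_ mb]].
  have [p pp pb] := pdivP b1; have p1 := prime_gt1 pp; have p0 := prime_gt0 pp.
  exists (p ^ 2), p; split=> [|N Np]; first by rewrite expn_gt0 p0.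
  have Nmod : N %% p ^ 2 = p by rewrite Np modn_small // -mulnn ltn_Pmulr.
  have pN : p %| N.
    by rewrite (divn_eq N (p ^ 2)) Nmod dvdn_addl // -mulnn mulnA dvdn_mull.
  have p2N : ~~ (p ^ 2 %| N) by rewrite /dvdn Nmod -lt0n.
  split=> [d|q pq].
    rewrite ltnS leqn0 => /eqP ->; rewrite addn0; apply/squarefreeP => -[_].
    by move=> /(_ p p1)/negP; apply; rewrite -mulnn dvdn_mul.
  by rewrite Euclid_dvdX // dvdn_prime2 // => /andP[/eqP -> _].
have [|Q [a [Q0 HQ]]] := IH; first exact: ltnW.
(* Being above [Q + b], the new prime is coprime to [Q] and to [b] and exceeds every digit. *)
have [p pQb pp] := prime_above (Q + b).
have p0 := prime_gt0 pp; have p1 := prime_gt1 pp.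
have cop x : 0 < x -> x <= Q + b -> coprime x (p ^ 2).
  move=> x0 xle; rewrite coprimeXr // coprime_sym prime_coprime //.
  by apply/negP => /(dvdn_leq x0); rewrite leqNgt (leq_ltn_trans xle).
have copQ : coprime Q (p ^ 2) by rewrite cop ?leq_addr.
have copb : coprime b (p ^ 2) by rewrite cop ?leq_addl // ltnW.
(* As [x] is [m.+1] modulo [b] and [0] modulo [p ^ 2], its quotient by [b] is a solution [N] of
   [p ^ 2 %| b * N + m.+1]. *)
pose x := chinese b (p ^ 2) m.+1 0.
have xb : x %% b = m.+1 by rewrite chinese_modl // modn_small.
have px : p ^ 2 %| b * (x %/ b) + m.+1.
  by rewrite -xb mulnC -divn_eq /dvdn chinese_modr // mod0n.
exists (Q * p ^ 2), (chinese Q (p ^ 2) a (x %/ b)).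
split=> [|N /eqP]; first by rewrite muln_gt0 Q0 expn_gt0 p0.
rewrite chinese_remainder // chinese_modl // chinese_modr // => /andP[/eqP Na /eqP Nx].
have [Hd Hp] := HQ N Na.
have pN : p ^ 2 %| b * N + m.+1.
  rewrite /dvdn -modnDml -modnMmr Nx modnMmr modnDml; exact: px.
split=> [d|q pq].
  rewrite ltnS leq_eqVlt => /orP[/eqP ->|]; last exact: Hd.
  by apply/squarefreeP => -[_ /(_ p p1)]; rewrite pN.
rewrite Euclid_dvdM // => /orP[|]; first exact: Hp.
rewrite Euclid_dvdX // dvdn_prime2 // => /andP[/eqP -> _].
(* Otherwise [p] would divide the nonzero digit [m.+1], which is smaller than [p]. *)
apply/negP => p2N.
have dvp n : p ^ 2 %| n -> p %| n by apply: dvdn_trans; rewrite -mulnn dvdn_mulr.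
have : p %| m.+1 by rewrite -(dvdn_addr m.+1 (dvdn_mull b (dvp _ p2N))) dvp.
move/(dvdn_leq (ltn0Sn m)); rewrite leqNgt (leq_trans mb) // ltnW //.
by rewrite (leq_ltn_trans _ pQb) ?leq_addl.
Qed.

Lemma count_residue (Q a : nat) : a < Q ->
  count (fun N => N %% Q == a) (iota 0 Q) = 1.
Proof.
move=> aQ; rewrite (@eq_in_count _ _ (pred1 a)); last first.
  by move=> N; rewrite mem_iota add0n => /andP[_ NQ] /=; rewrite modn_small.
by rewrite count_uniq_mem ?iota_uniq // mem_iota aQ.
Qed.

(** A member of the class that is not a dead end is divisible by the square of a prime. Below [z]
    the prime square and the class combine into one class modulo [Q * k ^ 2], with a rounding error
    of one per term. From [z] on the class is forgotten, so that these roundings do not accumulate.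
    The last [1] pays for [N = 0]. *)
Lemma dead_end_class_count (b Q a z n : nat) : 0 < z -> 0 < Q -> a < Q ->
  (forall N, N %% Q = a ->
    (forall d, d < b -> ~~ squarefree (b * N + d)) /\
    (forall p, prime p -> p %| Q -> ~~ (p ^ 2 %| N))) ->
  n.+1 %/ Q <= count (dead_end b) (iota 1 n)
    + (\sum_(2 <= k < z) (n.+1 %/ (Q * k ^ 2)).+1
      + \sum_(z <= k < n.+1) n %/ k ^ 2) + 1.
Proof.
move=> z0 Q0 aQ HQ; pose f N := N %% Q == a.
have fQ N : f (N + Q) = f N by rewrite /f modnDr.
have [cf _] := andP (count_iota_periodic n.+1 Q0 fQ).
move: cf; rewrite count_residue // muln1 => /leq_trans; apply.
rewrite -[iota 0 n.+1]/([:: 0] ++ iota 1 n) count_cat addnC.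
apply: leq_add; last exact: count_size.
(* The test [~~ (k %| Q)] is harmless, since members of the class avoid squares of primes dividing
   [Q]; it makes [Q] and [k ^ 2] coprime. *)
pose g k N := [&& prime k, ~~ (k %| Q), f N & k ^ 2 %| N].
pose h k N := k ^ 2 %| 1 * N + 0.
apply: (@leq_trans (count (predU (dead_end b)
  (predU (fun N => has (g^~ N) (index_iota 2 z))
         (fun N => has (h^~ N) (index_iota z n.+1)))) (iota 1 n))).
  apply: sub_in_count => N; rewrite mem_iota add1n ltnS => /andP[N1 Nn] fN /=.
  have [Hd Hp] := HQ N (eqP fN).
  case: (boolP (squarefree N)) => [sq|nsq].
    apply/orP; left; rewrite /dead_end sq; apply/allP => d.
    by rewrite mem_iota => /andP[_ db]; exact: Hd.
  have [p pp dv] := not_squarefree_prime N1 nsq.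
  apply/orP; right; apply/orP; case: (ltnP p z) => pz; [left|right].
    apply/hasP; exists p; first by rewrite mem_index_iota prime_gt1.
    by rewrite /g pp fN dv /= andbT; apply: contraL dv; exact: Hp.
  apply/hasP; exists p; last by rewrite /h mul1n addn0.
  rewrite mem_index_iota pz ltnS (leq_trans _ Nn) //.
  by have := dvdn_leq N1 dv; have := prime_gt0 pp; nia.
apply: leq_trans (count_predU_le _ _ _) _; rewrite leq_add2l.
apply: leq_trans (count_predU_le _ _ _) _.
apply: leq_add; apply: leq_trans (count_has_le _ _ _) _;
  rewrite big_seq [leqRHS]big_seq; apply: leq_sum => k;
  rewrite mem_index_iota => /andP[lek _].
  case: (boolP (prime k && ~~ (k %| Q))) => [/andP[pk kQ]|nk]; last first.
    rewrite (@eq_count _ _ pred0) ?count_pred0 // => N /=.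
    by rewrite /g andbA (negbTE nk).
  have k20 : 0 < k ^ 2 by rewrite expn_gt0 prime_gt0.
  have gper N : predI f (fun N => N %% k ^ 2 == 0) (N + Q * k ^ 2) =
                predI f (fun N => N %% k ^ 2 == 0) N.
    by rewrite /= /f addnC modnMDl [(Q * _)%N]mulnC modnMDl.
  have Qk0 : 0 < Q * k ^ 2 by rewrite muln_gt0 Q0.
  have [_] := andP (count_iota_periodic n.+1 Qk0 gper).
  rewrite count_iota_coprime ?count_residue //; last first.
  - by move=> N; rewrite modnDr.
  - by rewrite coprimeXr // coprime_sym prime_coprime.
  rewrite !muln1; apply: leq_trans.
  rewrite -[iota 0 n.+1]/([:: 0] ++ iota 1 n) count_cat.
  apply: leq_trans (leq_addl _ _); apply: sub_count => N.
  by rewrite /g pk kQ.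
apply: leq_trans (count_dvd_affine _ _ _ _) _ => //; last by rewrite mul1n addn0.
by rewrite expn_gt0 (leq_trans z0).
Qed.

Local Open Scope ring_scope.

(** * Densities *)

(** Telescoping with $1/k^2 \le 1/(k-1) - 1/k$; the induction keeps the negative end term. *)
Lemma sum_inv_sq_le (R : realFieldType) (m n : nat) : (0 < m)%N ->
  \sum_(m.+1 <= k < n) ((k ^ 2)%:R : R)^-1 <= m%:R^-1.
Proof.
move=> m0.
case: (leqP n m.+1) => [le|/ltnW /subnKC <-]; first by rewrite big_geq // invr_ge0.
suff : \sum_(m.+1 <= k < m.+1 + (n - m.+1)) ((k ^ 2)%:R : R)^-1
    <= m%:R^-1 - (m + (n - m.+1))%:R^-1.
  by move=> /le_trans; apply; rewrite gerBl invr_ge0.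
elim: (n - m.+1)%N => [|j IH]; first by rewrite !addn0 big_geq // subrr.
rewrite addnS big_nat_recr /=; last by rewrite leq_addr.
apply: le_trans (lerD IH (lexx _)) _.
rewrite addnS addSn; set t := (m + j)%N.
have t0 : 0 < t%:R :> R by rewrite ltr0n addn_gt0 m0.
have key (x y z w : R) : y + w <= z -> x - z + w <= x - y by move=> H; lra.
apply: key.
have -> : t.+1%:R = t%:R + 1 :> R by rewrite -natr1.
rewrite natrX -natr1 -subr_ge0.
have -> : (t%:R : R)^-1 - ((t%:R + 1)^-1 + ((t%:R + 1) ^+ 2)^-1)
   = (t%:R * (t%:R + 1) ^+ 2)^-1.
  by field; rewrite !gt_eqF // addr_gt0.
by rewrite invr_ge0 mulr_ge0 ?sqr_ge0 // ltW.
Qed.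

Lemma partial_prodS (R : realType) (b : nat) (S : {set 'I_b}) (M : nat) :
  partial_prod R S M.+1 =
  partial_prod R S M * (if prime M then 1 - (nu M S)%:R / (M ^ 2)%:R else 1).
Proof. by rewrite /partial_prod big_mkcond big_nat_recr //= -big_mkcond. Qed.

Lemma nu_ratio_le1 (R : realType) (b : nat) (S : {set 'I_b}) (M : nat) :
  prime M -> (nu M S)%:R / (M ^ 2)%:R <= 1 :> R.
Proof.
move=> pM; rewrite ler_pdivrMr ?mul1r ?ler_nat ?nu_le_mod //.
by rewrite ltr0n expn_gt0 prime_gt0.
Qed.

Lemma partial_prod_ge0 (R : realType) (b : nat) (S : {set 'I_b}) (M : nat) :
  0 <= partial_prod R S M.
Proof.
by rewrite /partial_prod prodr_ge0 // => p pr; rewrite subr_ge0 nu_ratio_le1.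
Qed.

Lemma partial_prod_nonincreasing (R : realType) (b : nat) (S : {set 'I_b}) :
  {homo partial_prod R S : m n / (m <= n)%N >-> n <= m}.
Proof.
apply/nonincreasing_seqP => M; rewrite partial_prodS ler_piMr ?partial_prod_ge0 //.
by case: ifP => // _; rewrite gerBl divr_ge0.
Qed.

Lemma partial_prod_le1 (R : realType) (b : nat) (S : {set 'I_b}) (M : nat) :
  partial_prod R S M <= 1.
Proof.
apply: (le_trans (partial_prod_nonincreasing R S (leq0n M))).
by rewrite /partial_prod big_nil.
Qed.

(** Monotonicity is used rather than logarithms because factors may vanish, for instance at [p = 2]
    when [4] divides [b] and [0] is in [S]. *)
Lemma cvg_partial_prod (R : realType) (b : nat) (S : {set 'I_b}) :
  cvgn (partial_prod R S).
Proof.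
apply: nonincreasing_is_cvgn; first exact: partial_prod_nonincreasing.
by exists 0 => _ [M _ <-]; exact: partial_prod_ge0.
Qed.

(** Since partial products are at most [1], the factor at a prime [t] lowers them by at most
    [nu t S / t ^ 2], hence by $(b^2+1)/t^2$. Summing over [t > M] bounds every later partial
    product, and so the limit, from below. *)
Lemma partial_prod_tail (R : realType) (b : nat) (S : {set 'I_b}) (M : nat) :
  (0 < M)%N ->
  `|partial_prod R S M.+1 - limn (partial_prod R S)| <= (b * b + 1)%:R / M%:R.
Proof.
move=> M0.
rewrite ger0_norm; last first.
  rewrite subr_ge0.
  exact: nonincreasing_cvgn_ge (partial_prod_nonincreasing R S) (@cvg_partial_prod R b S) _.
rewrite lerBlDr -lerBlDl.
apply: limr_ge; first exact: cvg_partial_prod.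
exists M.+1 => // n /= /subnKC <-.
rewrite lerBlDl.
apply: (@le_trans _ _ (partial_prod R S (M.+1 + (n - M.+1)) + (b * b + 1)%:R *
   \sum_(M.+1 <= k < M.+1 + (n - M.+1)) ((k ^ 2)%:R : R)^-1)); last first.
  by rewrite addrC lerD2r ler_wpM2l // sum_inv_sq_le.
elim: (n - M.+1)%N => [|j IH]; first by rewrite addn0 big_geq // mulr0 addr0.
apply: (le_trans IH); rewrite (addnS M.+1 j).
have : (M.+1 <= M.+1 + j)%N by rewrite leq_addr.
move: (M.+1 + j)%N => t Mt; rewrite (big_nat_recr t) // partial_prodS /=.
have key (x y c s e : R) : x <= y + c * e -> x + c * s <= y + c * (s + e).
  by move=> H; lra.
apply: key.
have C0 : 0 <= (b * b + 1)%:R * ((t ^ 2)%:R : R)^-1 by rewrite mulr_ge0 ?invr_ge0.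
case: ifP => [pt|_]; last by rewrite mulr1 lerDl.
have H : partial_prod R S t * ((nu t S)%:R / (t ^ 2)%:R) <= (b * b + 1)%:R / (t ^ 2)%:R.
  apply: (@le_trans _ _ (1 * ((nu t S)%:R / (t ^ 2)%:R))).
    by rewrite ler_wpM2r ?divr_ge0 ?partial_prod_le1.
  by rewrite mul1r ler_wpM2r ?invr_ge0 // ler_nat nu_le ?prime_gt0.
by rewrite mulrBr mulr1 -lerBlDl opprB addrCA subrr addr0.
Qed.

(** * Asymptotic counts of sifted and of square-free integers *)

Lemma count_sifted_period (R : realType) (b : nat) (S : {set 'I_b}) (M : nat) :
  (count (sifted S M) (iota 0 (sq_primorial M)))%:R =
    (sq_primorial M)%:R * partial_prod R S M.
Proof.
elim: M => [|M IH].
  by rewrite /partial_prod /sq_primorial !big_nil mulr1.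
rewrite count_siftedS natrM IH partial_prodS sq_primorialS natrM.
case: ifP => pM; last by rewrite !mulr1.
rewrite natrB ?nu_le_mod //.
have p0 : ((M ^ 2)%:R : R) != 0 by rewrite pnatr_eq0 -lt0n expn_gt0 prime_gt0.
by move: (M ^ 2)%:R p0 => q q0; field.
Qed.

(** Full periods are counted exactly, the incomplete one costs at most the period, and passing from
    [iota 0 n.+1] to [iota 1 n] costs the [1]. *)
Lemma count_sifted_approx (R : realType) (b : nat) (S : {set 'I_b}) (M n : nat) :
  `|(count (sifted S M) (iota 1 n))%:R - n%:R * partial_prod R S M|
    <= (sq_primorial M)%:R + 1.
Proof.
set Q := sq_primorial M; set P := partial_prod R S M.
have Q0 : (0 < Q)%N := sq_primorial_gt0 M.
have [P0 P1] : 0 <= P /\ P <= 1 by rewrite partial_prod_ge0 partial_prod_le1.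
have := count_iota_periodic n.+1 Q0 (sifted_periodic S M).
rewrite -[iota 0 n.+1]/([:: 0%N] ++ iota 1 n) count_cat.
set e := count _ [:: 0%N]; set c := count _ (iota 1 n).
have e1 : (e <= 1)%N by exact: count_size.
rewrite -!(ler_nat R) !natrM natrD count_sifted_period -/P -/Q => /andP[lo hi].
have qr : n%:R + 1 = (n.+1 %/ Q)%:R * Q%:R + (n.+1 %% Q)%:R :> R.
  by rewrite -natrM -natrD -divn_eq natr1.
have r0 : 0 <= (n.+1 %% Q)%:R :> R by [].
have rQ : (n.+1 %% Q)%:R <= Q%:R :> R by rewrite ler_nat ltnW // ltn_pmod.
have e0 : 0 <= e%:R :> R by [].
have e1' : e%:R <= 1 :> R by rewrite lern1.
move: lo hi; rewrite -natr1.
have -> : n%:R = (n.+1 %/ Q)%:R * Q%:R + (n.+1 %% Q)%:R - 1 :> R by rewrite -qr addrK.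
move: (n.+1 %/ Q)%:R (n.+1 %% Q)%:R r0 rQ => q r r0 rQ lo hi.
rewrite ler_norml; apply/andP; split; nra.
Qed.

(** Three errors add up: primes above [M], the period, and the tail of the product. The first and
    third contribute [2] and [1] to the coefficient, for which [4] leaves room. *)
Lemma sqfree_on_approx (R : realType) (b : nat) (S : {set 'I_b}) (M n : nat) :
  (0 < b)%N -> (0 < M)%N -> (0 < n)%N ->
  `|(count (sqfree_on S) (iota 1 n))%:R - n%:R * limn (partial_prod R S)|
    <= (sq_primorial M.+1)%:R + 1 + 4 * (b.+1 * b.+1)%:R * n%:R / M%:R.
Proof.
move=> b0 M0 n0.
set L := limn _; set A := count _ _.
set G := count (sifted S M.+1) (iota 1 n); set P := partial_prod R S M.+1.
have AG : `|(A%:R : R) - G%:R| <= 2 * (b.+1 * b.+1)%:R * n%:R / M%:R.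
  rewrite distrC ger0_norm; last first.
    by rewrite subr_ge0 ler_nat; apply: sub_count => N; exact: sqfree_on_sifted.
  rewrite lerBlDl.
  have := count_sifted_le S n b0 (ltn0Sn M).
  rewrite -/G -/A -(ler_nat R) natrD => /le_trans; apply; rewrite lerD2l.
  rewrite raddf_sum /=.
  apply: (@le_trans _ _ (\sum_(M.+1 <= k < b * n.+1)
      (b.+1 * (b * n.+1))%:R * ((k ^ 2)%:R : R)^-1)).
    rewrite big_seq [leRHS]big_seq; apply: ler_sum => k.
    rewrite mem_index_iota => /andP[Mk _].
    have k2 : 0 < (k ^ 2)%:R :> R by rewrite ltr0n expn_gt0 (leq_trans _ Mk).
    by rewrite ler_pdivlMr // -natrM ler_nat -mulnA leq_mul2l leq_divM orbT.
  rewrite -mulr_sumr.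
  apply: le_trans (ler_wpM2l _ (sum_inv_sq_le R _ M0)) _ => //.
  (* The factor [2] absorbs [n.+1 <= 2 * n], valid as [n] is positive. *)
  rewrite ler_wpM2r ?invr_ge0 // -!natrM ler_nat.
  by nia.
have GP := count_sifted_approx R S M.+1 n; rewrite -/G -/P in GP.
have PL : `|n%:R * P - n%:R * L| <= (b.+1 * b.+1)%:R * n%:R / M%:R.
  rewrite -mulrBr normrM ger0_norm // mulrAC mulrC ler_wpM2r //.
  apply: le_trans (partial_prod_tail _ _ M0) _.
  by rewrite ler_wpM2r ?invr_ge0 // ler_nat; nia.
have K0 : 0 <= (b.+1 * b.+1)%:R * n%:R / M%:R :> R by rewrite divr_ge0 ?mulr_ge0.
have -> : A%:R - n%:R * L = (A%:R - G%:R) + (G%:R - n%:R * P) + (n%:R * P - n%:R * L).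
  by ring.
apply: le_trans (ler_normD _ _) _; apply: le_trans (lerD (ler_normD _ _) (lexx _)) _.
lra.
Qed.

(** * Inclusion-exclusion over the digits *)

Lemma natr_forall (R : comPzRingType) (I : finType) (P F : pred I) :
  [forall (i | P i), F i]%:R = \prod_(i | P i) (F i)%:R :> R.
Proof.
case: (boolP [forall (i | P i), F i]) => [/forall_inP allF|].
  by rewrite big1 // => i /allF ->.
rewrite negb_forall => /existsP[i]; rewrite negb_imply => /andP[Pi /negbTE nF].
by rewrite (bigD1 i) //= nF mul0r.
Qed.

(** The indicator is a product over digits [d] of one minus the indicator that [b * N + d] is
    square-free; expanding it gives one term per subset. *)
Lemma dead_endE (R : comPzRingType) (b N : nat) :
  (dead_end b N)%:R = \sum_(S : {set 'I_b}) (-1) ^+ #|S| * (sqfree_on S N)%:R :> R.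
Proof.
have -> : dead_end b N =
    squarefree N && [forall (d : 'I_b | true), ~~ squarefree (b * N + d)].
  congr andb; apply/allP/forallP => [H d|H d]; first by apply: H; rewrite mem_iota /=.
  by rewrite mem_iota => /andP[_ db]; exact: H (Ordinal db).
rewrite -mulnb natrM natr_forall.
under eq_bigr => d _.
  have -> : (~~ squarefree (b * N + d))%:R = - (squarefree (b * N + d))%:R + 1 :> R.
    by case: squarefree; rewrite ?addNr // oppr0 add0r.
  over.
rewrite bigA_distr mulr_sumr; apply: eq_bigr => S _.
by rewrite -big_mkcond prodrN -natr_forall mulrCA /sqfree_on -mulnb natrM.
Qed.

Lemma count_dead_endE (R : comPzRingType) (b : nat) (s : seq nat) :
  (count (dead_end b) s)%:R =
    \sum_(S : {set 'I_b}) (-1) ^+ #|S| * (count (sqfree_on S) s)%:R :> R.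
Proof.
elim: s => [|N s IH] /=; first by rewrite big1 // => S _; rewrite mulr0.
rewrite natrD IH dead_endE -big_split; apply: eq_bigr => S _.
by rewrite natrD mulrDr.
Qed.

Lemma count_dead_end_approx (R : realType) (b M n : nat) :
  (0 < b)%N -> (0 < M)%N -> (0 < n)%N ->
  `|(count (dead_end b) (iota 1 n))%:R - n%:R * c_dead R b| <=
    #|{set 'I_b}|%:R * ((sq_primorial M.+1)%:R + 1
                        + 4 * (b.+1 * b.+1)%:R * n%:R / M%:R).
Proof.
move=> b0 M0 n0; rewrite count_dead_endE /c_dead mulr_sumr -sumrB.
apply: le_trans (ler_norm_sum _ _ _) _.
rewrite mulr_natl -sumr_const; apply: ler_sum => S _.
by rewrite mulrCA -mulrBr normrMsign sqfree_on_approx.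
Qed.

(* This makes the sifting level [M = floor (sqrt (ln X))] admissible. *)
Lemma sq_primorial_le_exp (R : realType) (M : nat) : (0 < M)%N ->
  (sq_primorial M.+1)%:R * M%:R <= expR (M%:R ^+ 2) :> R.
Proof.
elim: M => // -[_ _|M IH _].
  rewrite !sq_primorialS /sq_primorial big_nil /= !muln1 mulr1 expr1n.
  by have := expR_ge1Dx (1 : R); lra.
have {}IH := IH isT.
rewrite sq_primorialS; set Q := sq_primorial M.+2 in IH *.
have Q0 : 0 <= Q%:R :> R by [].
apply: (@le_trans _ _ (Q%:R * M.+2%:R ^+ 2 * M.+2%:R)).
  rewrite ler_wpM2r // natrM ler_wpM2l // -natrX ler_nat.
  by case: ifP => // _; rewrite expn_gt0.
rewrite -[M.+2]addn1 natrD; set m := M.+1%:R in IH *.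
have m1 : 1 <= m :> R by rewrite ler1n.
(* The three new exponential factors are at least [m + 1], [m + 1] and [2]; what remains is
   [m + 1 <= 2 * m]. *)
have -> : (m + 1) ^+ 2 = m ^+ 2 + m + m + 1 by ring.
rewrite !expRD.
have em : m + 1 <= expR m by rewrite addrC expR_ge1Dx.
have e1 : 2 <= expR 1 :> R by have := expR_ge1Dx (1 : R); lra.
apply: (@le_trans _ _ (Q%:R * m * (m + 1) * (m + 1) * 2)).
  rewrite -subr_ge0.
  have -> : Q%:R * m * (m + 1) * (m + 1) * 2 - Q%:R * (m ^+ 2 + m + m + 1) * (m + 1)
     = Q%:R * (m + 1) ^+ 2 * (m - 1) by ring.
  by apply: mulr_ge0; [rewrite mulr_ge0 ?sqr_ge0|rewrite subr_ge0].
by rewrite !ler_pM // ?mulr_ge0 //; lra.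
Qed.

(* From [1 - 1/6 <= exp (- 1/6)] one gets [exp 1 <= (6/5)^6 < 3]. *)
Lemma ln_ge1 (R : realType) (x : R) : 3 <= x -> 1 <= ln x.
Proof.
move=> x3; rewrite -ler_expR lnK ?posrE; last by lra.
apply: le_trans x3.
have -> : 1 = 6%:R * 6^-1 :> R by lra.
rewrite expRM_natl.
have inv := expRxMexpNx_1 (6^-1 : R).
have lo : 1 + - 6^-1 <= expR (- 6^-1) :> R := expR_ge1Dx _.
have e0 := expR_gt0 (6^-1 : R).
have hi : expR 6^-1 <= 6 / 5 :> R by nra.
apply: (@le_trans _ _ ((6 / 5) ^+ 6)); last by lra.
by apply: lerXn2r => //; rewrite nnegrE; [exact: ltW|lra].
Qed.

(** * Positivity of the constant *)

Lemma dead_end_lower (R : realType) (b : nat) : (1 < b)%N ->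
  exists2 delta : R, 0 < delta & exists C : R, forall n,
    delta * n%:R - C <= (count (dead_end b) (iota 1 n))%:R.
Proof.
move=> b1; have [Q [a [Q0 aQ HQ]]] := dead_end_class b1.
have Q0' : 0 < Q%:R :> R by rewrite ltr0n.
(* The class has density [1 / Q]. Small [k] remove at most [3 / 4] of it and, for this [z], large
   [k] at most [1 / 8]; the remaining [1 / 8] is the witness for [delta]. *)
pose z := (8 * Q).+1.
exists (8 * Q%:R)^-1; first by rewrite invr_gt0 mulr_gt0.
exists (2 + z%:R) => n.
have := dead_end_class_count n (ltn0Sn (8 * Q)) Q0 aQ HQ; rewrite -/z.
set D := count _ _; rewrite -(ler_nat R) !natrD !raddf_sum /=.
set A := \sum_(2 <= k < z) _; set B := \sum_(z <= k < n.+1) _.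
set y := n.+1%:R / Q%:R : R.
have Bn : B <= n%:R * (8 * Q%:R)^-1.
  apply: (@le_trans _ _ (\sum_(z <= k < n.+1) n%:R * ((k ^ 2)%:R : R)^-1)).
    rewrite /B big_seq [leRHS]big_seq; apply: ler_sum => k.
    rewrite mem_index_iota => /andP[zk _].
    rewrite ler_pdivlMr ?ltr0n ?expn_gt0 ?(leq_trans _ zk) //.
    by rewrite -natrM ler_nat leq_divM.
  rewrite -mulr_sumr ler_wpM2l // -natrM; apply: sum_inv_sq_le.
  by rewrite muln_gt0.
have An : A <= y * (3 / 4) + z%:R.
  apply: (@le_trans _ _ (\sum_(2 <= k < z) (y * ((k ^ 2)%:R : R)^-1 + 1))).
    rewrite /A big_seq [leRHS]big_seq; apply: ler_sum => k.
    rewrite mem_index_iota => /andP[k2 _].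
    rewrite -natr1 lerD2r /y -mulrA -invfM -natrM ler_pdivlMr; last first.
      by rewrite ltr0n muln_gt0 Q0 expn_gt0 (leq_trans _ k2).
    by rewrite -natrM ler_nat leq_divM.
  rewrite big_split /= -mulr_sumr; apply: lerD; last first.
    by rewrite sumr_const_nat ler_nat leq_subr.
  (* Telescoping from [k = 2] would only give [1]; splitting off the term [1 / 4] leaves at most
     [1 / 2]. *)
  rewrite ler_wpM2l ?divr_ge0 // big_ltn; last by rewrite /z; lia.
  have := sum_inv_sq_le R z (isT : 0 < 2)%N; lra.
have yn : y <= (n.+1 %/ Q)%:R + 1.
  by rewrite /y ler_pdivrMr // natr1 -natrM ler_nat ltnW // ltn_ceil.
have yQ : 8 * (8 * Q%:R)^-1 * (n%:R + 1) = y.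
  by rewrite /y -natr1; field; rewrite gt_eqF.
have d0 : 0 < (8 * Q%:R : R)^-1 by rewrite invr_gt0 mulr_gt0.
move: Bn An yn yQ d0; set e := (8 * Q%:R)^-1 => *.
have n0 : 0 <= n%:R :> R by [].
nra.
Qed.

(** If the constant were not positive, the approximation with a fixed large [M] would bound the
    count by [delta / 2 * n] plus a constant, against the lower bound of slope [delta] once [n] is
    large. *)
Lemma c_dead_gt0 (R : realType) (b : nat) : (1 < b)%N -> 0 < c_dead R b.
Proof.
move=> b1; have b0 : (0 < b)%N by exact: ltnW.
have [delta d0 [C lower]] := dead_end_lower R b1.
pose H := #|{set 'I_b}|%:R : R; pose K := 4 * (b.+1 * b.+1)%:R : R.
have H0 : 0 <= H by [].
have K0 : 0 <= K by rewrite mulr_ge0.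
pose M := (Num.truncn (2 * (H * K) / delta)).+1.
have M0 : 0 < M%:R :> R by rewrite ltr0n.
have HKM : H * (K / M%:R) <= delta / 2.
  have : 2 * (H * K) / delta < M%:R := truncnS_gt _.
  by rewrite ltr_pdivrMr // => lt_M; rewrite mulrA ler_pdivrMr //; lra.
pose B := C + H * ((sq_primorial M.+1)%:R + 1).
rewrite ltNge; apply/negP => c0.
pose n := (Num.truncn (2 * B / delta)).+1.
have n0 : 0 < n%:R :> R by rewrite ltr0n.
have nB : B < delta / 2 * n%:R.
  have : 2 * B / delta < n%:R := truncnS_gt _.
  by rewrite ltr_pdivrMr // => nB; lra.
have := count_dead_end_approx R b0 (ltn0Sn _ : (0 < M)%N) (ltn0Sn _ : (0 < n)%N).
rewrite -/H -/K ler_norml => /andP[_ up].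
have := lower n.
have cn : n%:R * c_dead R b <= 0 by rewrite mulr_ge0_le0 // ltW.
have HKMn := ler_wpM2r (ltW n0) HKM.
have E : K * n%:R / M%:R = K / M%:R * n%:R by rewrite mulrAC.
rewrite E in up; rewrite /B in nB.
lra.
Qed.

Theorem theorem1p2 (R : realType) (b : nat) (hb : (2 <= b)%N) :
  (forall S : {set 'I_b}, cvgn (partial_prod R S)) /\
  0 < c_dead R b /\
  exists C : R, forall X : R, 3 <= X ->
    `| (Dcount b X)%:R - c_dead R b * X | <= C * (X / Num.sqrt (ln X)).
Proof.
split; first by move=> S; exact: cvg_partial_prod.
split; first exact: c_dead_gt0.
have b0 : (0 < b)%N by exact: ltnW.
pose H := #|{set 'I_b}|%:R : R; pose K := 4 * (b.+1 * b.+1)%:R : R.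
have H0 : 0 <= H by [].
have K0 : 0 <= K by rewrite mulr_ge0.
(* In units of [X / s], which is at least [1]: [2] pays for the period, [1] for the added one,
   [K * 2] for large primes and the tail, and [c_dead R b] for replacing [X] by its floor. *)
exists (H * (2 + 1 + K * 2) + c_dead R b) => X X3.
have X0 : 0 < X by lra.
have lnX := ln_ge1 X3.
set s := Num.sqrt (ln X).
have s2 : s ^+ 2 = ln X by rewrite sqr_sqrtr //; lra.
have s1 : 1 <= s by rewrite -sqrtr1 ler_wsqrtr.
have s0 : 0 < s by lra.
have sX : s <= X by have := ln_sublinear X0; nra.
have /andP[nX Xn] := truncn_itv (ltW X0).
have /andP[Ms sM] := truncn_itv (ltW s0).
rewrite /Dcount; set n := Num.truncn X in nX Xn *; set M := Num.truncn s in Ms sM.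
have n0 : (0 < n)%N by rewrite truncn_gt0; lra.
have M0 : (0 < M)%N by rewrite truncn_gt0.
have M1 : 1 <= M%:R :> R by rewrite ler1n.
(* From [s < M + 1] and [1 <= M] one gets [s <= 2 * M]. *)
have Mi : M%:R^-1 <= 2 / s.
  rewrite ler_pdivlMr // mulrC ler_pdivrMr; last lra.
  by move: sM; rewrite -natr1; lra.
have Xs1 : 1 <= X / s by rewrite ler_pdivlMr // mul1r.
(* As [M ^ 2 <= s ^ 2 = ln X], the exponential bound puts the period below [X / M]. *)
have QX : (sq_primorial M.+1)%:R <= 2 * (X / s).
  apply: (@le_trans _ _ (X / M%:R)); last first.
    by rewrite mulrCA ler_wpM2l // ltW.
  rewrite ler_pdivlMr; last lra.
  apply: le_trans (sq_primorial_le_exp _ M0) _.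
  rewrite -[leRHS]lnK ?posrE // ler_expR -s2 lerXn2r ?nnegrE //.
  exact: ltW.
have KX : K * n%:R / M%:R <= K * 2 * (X / s).
  have -> : K * 2 * (X / s) = K * (X * (2 / s)) by ring.
  by rewrite -mulrA; apply: ler_wpM2l => //; apply: ler_pM; rewrite ?invr_ge0.
have cX : `|n%:R * c_dead R b - c_dead R b * X| <= c_dead R b * (X / s).
  have c0 := c_dead_gt0 R hb.
  rewrite mulrC -mulrBr normrM gtr0_norm // ler_pM2l // distrC ger0_norm ?subr_ge0 //.
  by move: Xn; rewrite -natr1; lra.
have := count_dead_end_approx R b0 M0 n0; rewrite -/H -/K => app.
rewrite -(subrK (n%:R * c_dead R b) (count _ _)%:R) -addrA.
apply: le_trans (ler_normD _ _) _; rewrite mulrDl; apply: lerD cX.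
apply: le_trans app _; rewrite -[leRHS]mulrA; apply: ler_wpM2l => //.
by rewrite !mulrDl; lra.
Qed.
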